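(* Let $p$ be a prime. Let $a,b$ be integers with $1\le b\le a$, $\nu(a-b)=0$, and $\{\nu(a),\nu(b)\}=\{0,k\}$ for some integer $k\ge 0$. Let $c=a$ if $\nu(a)=k$ and $c=b$ if $\nu(b)=k$. Then for every positive integer $e$, $$\mathrm{u}\binom{ap^e}{bp^e}\equiv(-1)^{pck}\,\frac{z_a}{z_b\,z_{a-b}}\pmod{p^e}$$ (congruence in $\mathbb{Z}_p$).
   Context: For a prime $p$ and a positive integer $n$, $\nu(n)$ denotes the exponent of $p$ in $n$ and $\mathrm{u}(n)=n/p^{\nu(n)}$ its unit part. For a positive integer $\alpha$ not divisible by $p$, $z_\alpha\in\mathbb{Z}_p$ denotes the $p$-adic limit $\lim_{e\to\infty}(-1)^{p\alpha e}\mathrm{u}((\alpha p^e)!)$ (which exists and is a $p$-adic unit). For an arbitrary positive integer $n$, $z_n:=z_{\mathrm{u}(n)}$. *)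

(* Defs.v *)
From HB Require Import structures.
From mathcomp Require Import all_boot all_order all_algebra.
From mathcomp Require Import boolp classical_sets filter topology.

Set Implicit Arguments.
Unset Strict Implicit.
Unset Printing Implicit Defensive.
Import GRing.Theory.
Local Open Scope ring_scope.
Local Open Scope classical_set_scope.

(* [unit_part p 0] is [0]. *)
Definition unit_part (p n : nat) : nat := (n %/ p ^ logn p n)%N.

(* Z_p as the inverse limit of the rings Z/p^(n+1), n >= 0. 'Z_m is Z/m only
   for m >= 2; for p <= 1 every 'Z_(p ^ n.+1) is Z/2, so that the limit is still
   a nonzero ring and no hypothesis on p is needed to build it. *)
Record padic_int (p : nat) := PadicInt {
  padic_res : forall n : nat, 'Z_(p ^ n.+1);
  padic_resP : forall n, (padic_res n.+1 : nat)%:R = padic_res n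
}.

Section PadicRing.
Variable p : nat.
Implicit Types x y z : padic_int p.

Lemma padic_int_inj x y : (forall n, padic_res x n = padic_res y n) -> x = y.
Proof.
case: x y => [f fP] [g gP] /= fg.
have E : f = g by apply: functional_extensionality_dep.
by case: _ / E gP => gP; congr PadicInt; exact: Prop_irrelevance.
Qed.

HB.instance Definition _ := gen_eqMixin (padic_int p).
HB.instance Definition _ := gen_choiceMixin (padic_int p).

Let modulus_dvd n : ((Zp_trunc (p ^ n.+1)).+2 %| (Zp_trunc (p ^ n.+2)).+2)%N.
Proof.
have [p1|p_le1] := ltnP 1 p.
  rewrite !Zp_cast; first by rewrite dvdn_exp2l.
    by rewrite -(exp1n n.+2) ltn_exp2r.
  by rewrite -(exp1n n.+1) ltn_exp2r.
by case: p p_le1 => [|[|q]] // _; rewrite ?exp0n ?exp1n.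
Qed.

Let red n (u : 'Z_(p ^ n.+2)) : 'Z_(p ^ n.+1) := (u : nat)%:R.

Let redE n u : red (n := n) u = inZp u.
Proof. exact: Zp_nat. Qed.

Let red0 n : red (n := n) 0 = 0. Proof. by []. Qed.

Let red1 n : red (n := n) 1 = 1.
Proof. by []. Qed.

Let redD n : {morph red (n := n) : u v / u + v}.
Proof.
move=> u v; rewrite !redE; apply: val_inj => /=.
by rewrite modn_dvdm ?modnDm.
Qed.

Let redM n : {morph red (n := n) : u v / u * v}.
Proof.
move=> u v; rewrite !redE; apply: val_inj => /=.
by rewrite modn_dvdm ?modnMm.
Qed.

Let redN n : {morph red (n := n) : u / - u}.
Proof.
by move=> u; apply/eqP; rewrite -addr_eq0 -redD addNr red0.
Qed.

Definition padic_zero : padic_int p := @PadicInt p (fun=> 0) red0.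

Definition padic_one : padic_int p := @PadicInt p (fun=> 1) red1.

Definition padic_add x y : padic_int p.
Proof.
exists (fun n => padic_res x n + padic_res y n) => n.
by rewrite -[LHS]/(red _) redD /red !padic_resP.
Defined.

Definition padic_opp x : padic_int p.
Proof.
exists (fun n => - padic_res x n) => n.
by rewrite -[LHS]/(red _) redN /red padic_resP.
Defined.

Definition padic_mul x y : padic_int p.
Proof.
exists (fun n => padic_res x n * padic_res y n) => n.
by rewrite -[LHS]/(red _) redM /red !padic_resP.
Defined.

Let addA : associative padic_add.
Proof. by move=> x y z; apply: padic_int_inj => n; exact: addrA. Qed.
Let addC : commutative padic_add.
Proof. by move=> x y; apply: padic_int_inj => n; exact: addrC. Qed.
Let add0 : left_id padic_zero padic_add.
Proof. by move=> x; apply: padic_int_inj => n; exact: add0r. Qed.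
Let addN : left_inverse padic_zero padic_opp padic_add.
Proof. by move=> x; apply: padic_int_inj => n; exact: addNr. Qed.

HB.instance Definition _ :=
  GRing.isZmodule.Build (padic_int p) addA addC add0 addN.

Let mulA : associative padic_mul.
Proof. by move=> x y z; apply: padic_int_inj => n; exact: mulrA. Qed.
Let mulC : commutative padic_mul.
Proof. by move=> x y; apply: padic_int_inj => n; exact: mulrC. Qed.
Let mul1 : left_id padic_one padic_mul.
Proof. by move=> x; apply: padic_int_inj => n; exact: mul1r. Qed.
Let mulD : left_distributive padic_mul +%R.
Proof. by move=> x y z; apply: padic_int_inj => n; exact: mulrDl. Qed.
Let oner_neq0 : padic_one != 0.
Proof.
by apply/eqP => /(congr1 (@padic_res p ^~ 0%N)) /eqP; apply/negP/oner_neq0.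
Qed.

HB.instance Definition _ :=
  GRing.Zmodule_isComNzRing.Build (padic_int p) mulA mulC mul1 mulD oner_neq0.

Definition padic_unit : {pred padic_int p} :=
  fun x => `[< exists y, y * x = 1 >].

Definition padic_inv x : padic_int p :=
  if x \in padic_unit then xget 0 [set y | y * x = 1] else x.

Let mulVx : {in padic_unit, left_inverse 1 padic_inv *%R}.
Proof.
move=> x xU; rewrite /padic_inv xU.
by case: xgetP => [_ _ //|]; have /asboolP[y yx /(_ y)] := xU.
Qed.
Let unitPl x y : y * x = 1 -> padic_unit x.
Proof. by move=> yx; apply/asboolP; exists y. Qed.
Let invr_out : {in [predC padic_unit], padic_inv =1 id}.
Proof. by move=> x /negbTE xU; rewrite /padic_inv xU. Qed.

HB.instance Definition _ :=
  GRing.ComNzRing_hasMulInverse.Build (padic_int p) mulVx unitPl invr_out.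

Definition padic_eqmod (e : nat) x y : Prop :=
  exists q : padic_int p, x - y = p%:R ^+ e * q.

Lemma padic_eqmod_refl e x : padic_eqmod e x x.
Proof. by exists 0; rewrite subrr mulr0. Qed.

Lemma padic_eqmod_trans e x y z :
  padic_eqmod e x y -> padic_eqmod e y z -> padic_eqmod e x z.
Proof.
by move=> [q xy] [r yz]; exists (q + r); rewrite mulrDr -xy -yz addrA subrK.
Qed.

Lemma padic_eqmod_leq d e x y :
  (d <= e)%N -> padic_eqmod e x y -> padic_eqmod d x y.
Proof.
move=> /subnKC <- [q xy]; exists (p%:R ^+ (e - d) * q).
by rewrite xy exprD mulrA.
Qed.

Definition padic_nbhs x : set_system (padic_int p) :=
  filter_from setT (fun e => [set y | padic_eqmod e y x]).

HB.instance Definition _ := hasNbhs.Build (padic_int p) padic_nbhs.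

Let nbhs_filter x : ProperFilter (nbhs x).
Proof.
apply: filter_from_proper => [|e _]; last by exists x; exact: padic_eqmod_refl.
apply: filter_from_filter => [|d e _ _]; first by exists 0%N.
exists (maxn d e) => // y yx.
by split; apply: padic_eqmod_leq yx; rewrite ?leq_maxl ?leq_maxr.
Qed.
Let nbhs_singleton x (A : set (padic_int p)) : nbhs x A -> A x.
Proof. by move=> [e _]; apply; exact: padic_eqmod_refl. Qed.
Let nbhs_nbhs x (A : set (padic_int p)) : nbhs x A -> nbhs x (nbhs^~ A).
Proof.
move=> [e _ eA]; exists e => // y yx; exists e => // z zy.
by apply: eA; exact: padic_eqmod_trans yx.
Qed.

HB.instance Definition _ := Nbhs_isNbhsTopological.Build (padic_int p)
  nbhs_filter nbhs_singleton nbhs_nbhs.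
HB.instance Definition _ := isPointed.Build (padic_int p) 0.

End PadicRing.

Definition padic_zseq (p alpha : nat) (e : nat) : padic_int p :=
  (-1) ^+ (p * alpha * e) * (unit_part p (alpha * p ^ e)`!)%:R.

Definition padic_z (p n : nat) : padic_int p :=
  lim (padic_zseq p (unit_part p n) @ \oo).

(* Main.v *)
Require Import Defs.
From mathcomp Require Import all_boot all_order all_algebra.
From mathcomp Require Import classical_sets filter topology.
Import GRing.Theory.
Local Open Scope ring_scope.

(** Write N(m) for the product of the i < m prime to p, so that u((np)!) = u(n!) N(np).
    The factors of N(p^e) are the units modulo p^e; pairing each with its inverse gives
    N(p^e)^2 = 1, and Wilson's theorem then gives N(p^e) = -1 modulo p^e for odd p, hence
    N(p^e)^p = (-1)^p for every p.  Therefore the sequence defining z_alpha is constant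
    modulo p^e from its e-th term on, which means that
      u((n p^e)!) = (-1)^(p n (e + nu(n))) z_n  modulo p^e  for every n.
    Dividing these congruences for n = a, b, a - b gives the result: the terms p n e in the
    exponents of -1 cancel because a = b + (a - b). *)

(** * Factorials, unit parts and the factors prime to [p] *)

Lemma prime_expn_gt1 (p e : nat) : prime p -> (0 < e)%N -> (1 < p ^ e)%N.
Proof. by move=> hp e0; rewrite -(exp1n e) ltn_exp2r // prime_gt1. Qed.

Definition coprime_prod (p n : nat) : nat :=
  (\prod_(0 <= i < n | ~~ (p %| i)) i)%N.

Lemma fact_mul_prime (p n : nat) : prime p ->
  ((n * p)`! = p ^ n * n`! * coprime_prod p (n * p))%N.
Proof.
move=> hp; have p_gt0 := prime_gt0 hp.
elim: n => [|n IHn]; first by rewrite /coprime_prod big_geq.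
have step j : (j < p)%N ->
    ((n * p + j)`! = p ^ n * n`! * coprime_prod p (n * p + j).+1)%N.
  elim: j => [_|j IHj jp].
    by rewrite addn0 IHn /coprime_prod big_mkcond [in RHS]big_mkcond
      big_nat_recr //= dvdn_mull // muln1.
  rewrite addnS factS IHj ?(ltnW jp) // /coprime_prod.
  rewrite [in RHS]big_mkcond big_nat_recr //= -big_mkcond /=.
  by rewrite -addnS dvdn_addr ?dvdn_mull // gtnNdvd //= mulnC !mulnA.
have -> : (n.+1 * p = (n * p + p.-1).+1)%N.
  by rewrite -addnS prednK // mulSn addnC.
rewrite factS step ?ltn_predL // -addnS prednK // factS expnS.
have -> : (n * p + p = p * n.+1)%N by rewrite mulnS addnC mulnC.
by rewrite !mulnA; congr (_ * _)%N; rewrite -!mulnA; congr muln; rewrite mulnCA.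
Qed.

Lemma unit_partE (p n : nat) : prime p -> (0 < n)%N -> unit_part p n = (n`_p^')%N.
Proof.
move=> hp n0; rewrite /unit_part -p_part -{1}(partnC p n0).
by rewrite mulKn // part_gt0.
Qed.

Lemma unit_partM (p m n : nat) : prime p -> (0 < m)%N -> (0 < n)%N ->
  unit_part p (m * n) = (unit_part p m * unit_part p n)%N.
Proof. by move=> hp m0 n0; rewrite !unit_partE ?partnM ?muln_gt0 ?m0. Qed.

Lemma unit_partX (p n : nat) : prime p -> unit_part p (p ^ n) = 1%N.
Proof. by move=> hp; rewrite /unit_part pfactorK // divnn expn_gt0 prime_gt0. Qed.

Lemma coprime_unit_part (p n : nat) : prime p -> (0 < n)%N -> coprime p (unit_part p n).
Proof.
by move=> hp n0; rewrite unit_partE // prime_coprime // -p'natE // part_pnat.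
Qed.

Lemma unit_part_id (p n : nat) : coprime p n -> unit_part p n = n.
Proof. by move=> cpn; rewrite /unit_part logn_coprime // divn1. Qed.

Lemma unit_part_split (p n : nat) : prime p ->
  (unit_part p n * p ^ logn p n = n)%N.
Proof. by move=> hp; rewrite /unit_part divnK // pfactor_dvdnn. Qed.

Lemma coprime_coprime_prod (p n : nat) : prime p -> coprime p (coprime_prod p n).
Proof.
move=> hp; rewrite /coprime_prod; elim/big_rec: _ => [|i m pi cpm].
  exact: coprimen1.
by rewrite coprimeMr cpm prime_coprime // pi.
Qed.

Lemma unit_part_fact_mul (p n : nat) : prime p ->
  unit_part p (n * p)`! = (unit_part p n`! * coprime_prod p (n * p))%N.
Proof.
move=> hp; have c := coprime_coprime_prod p (n * p) hp.
have c0 : (0 < coprime_prod p (n * p))%N.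
  by case: coprime_prod c => // /eqP; rewrite gcdn0 => p1; rewrite p1 in hp.
rewrite fact_mul_prime // !unit_partM ?unit_partX ?mul1n ?(unit_part_id _ _ c) //.
- by rewrite expn_gt0 prime_gt0.
- exact: fact_gt0.
- by rewrite muln_gt0 expn_gt0 prime_gt0 // fact_gt0.
Qed.

(** * The product of the numbers prime to [p] as a residue *)

Lemma natr_coprime_prod_mul (p m d t : nat) :
  (1 < m)%N -> (p %| d)%N -> (m %| d)%N ->
  (coprime_prod p (t * d))%:R = (coprime_prod p d)%:R ^+ t :> 'Z_m.
Proof.
move=> m1 pd md; elim: t => [|t IH]; first by rewrite mul0n /coprime_prod big_geq.
rewrite exprSr -{}IH -natrM /coprime_prod mulSn addnC.
(* The last of the blocks of length [d] is split off. Translation by [t * d] preserves divisibility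
   by [p], as [p %| d], and residues modulo [m], as [m %| d]. *)
rewrite (@big_cat_nat _ _ _ (t * d)) ?leq_addr //= natrM.
rewrite -{2}[(t * d)%N]add0n big_addn addnC addnK natrM; congr (_ * _).
rewrite !natr_prod; apply: eq_big => [i|i _].
  by rewrite dvdn_addl // dvdn_mull.
have d0 : d%:R = 0 :> 'Z_m.
  by rewrite -(divnK md) natrM pchar_Zp // mulr0.
by rewrite natrD natrM d0 mulr0 addr0.
Qed.

Lemma natr_coprime_prod (p e : nat) : prime p -> (0 < e)%N ->
  (coprime_prod p (p ^ e))%:R = \prod_(x : 'Z_(p ^ e) | x \is a GRing.unit) x.
Proof.
move=> hp e0; have m1 := prime_expn_gt1 p e hp e0.
rewrite /coprime_prod natr_prod.
rewrite -[X in index_iota 0 X](Zp_cast m1) big_mkord; apply: eq_big => [i|i _].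
  by rewrite -[in RHS](natr_Zp i) unitZpE // coprime_pexpl // prime_coprime.
by rewrite natr_Zp.
Qed.

Lemma natr_coprime_prod_sqr (p e : nat) : prime p -> (0 < e)%N ->
  (coprime_prod p (p ^ e))%:R ^+ 2 = 1 :> 'Z_(p ^ e).
Proof.
move=> hp e0; rewrite natr_coprime_prod // expr2.
rewrite {2}(reindex_inj (@invr_inj 'Z_(p ^ e))) /=.
under [X in _ * X]eq_bigl do rewrite unitrV.
by rewrite -big_split /= big1 // => x; exact: divrr.
Qed.

(* For odd p the square root of 1 given by the pairing is -1, since it is so modulo p. *)
Lemma natr_coprime_prodX (p e : nat) : prime p -> (0 < e)%N ->
  (coprime_prod p (p ^ e))%:R ^+ p = (-1) ^+ p :> 'Z_(p ^ e).
Proof.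
move=> hp e0; have m1 := prime_expn_gt1 p e hp e0.
move: (natr_coprime_prod_sqr _ _ hp e0).
have [->/= ->|podd sq] := even_prime hp; first by rewrite sqrrN expr1n.
suff -> : (coprime_prod p (p ^ e))%:R = -1 :> 'Z_(p ^ e) by [].
set P := coprime_prod _ _ in sq *.
have dvdZ m n : (1 < m)%N -> (n%:R == 0 :> 'Z_m) = (m %| n)%N.
  by move=> lt1m; rewrite -val_eqE /= val_Zp_nat.
have p1 := prime_gt1 hp.
(* Modulo [p], [P] is the power of (p-1)! with exponent p^(e-1), hence an odd power of -1 by
   Wilson's theorem. *)
have pP : (p %| P.+1)%N.
  rewrite -dvdZ // -natr1 addr_eq0 /P -(prednK e0) expnSr.
  rewrite natr_coprime_prod_mul //.
  have -> : coprime_prod p p = p.-1`!.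
    apply/eqP; rewrite -(eqn_pmul2l (prime_gt0 hp)); apply/eqP.
    have := fact_mul_prime p 1 hp; rewrite mul1n muln1 => <-.
    by case: (p) p1.
  have /eqP-> : ((p.-1)`!%:R == -1 :> 'Z_p).
    by rewrite -addr_eq0 natr1 dvdZ // -Wilson.
  by rewrite -signr_odd oddX podd orbT expr1.
have P0 : (0 < P)%N.
  case: P pP {sq} => // /dvdn_leq; case: (p) p1 => [|[|]] // ? _; exact.
(* If [p] divided both P - 1 and P + 1, it would divide 2. So P - 1 can be cancelled from (P - 1)(P
   + 1) = 0. *)
have U : P%:R - 1 \is a @GRing.unit 'Z_(p ^ e).
  rewrite -(prednK P0) -natr1 addrK unitZpE // coprimeXl // prime_coprime //.
  apply/negP => pP1; move: pP; rewrite -(prednK P0) -addn2 dvdn_addr //.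
  by move/(@dvdn_leq p 2 isT) => p2; case: (p) p1 p2 podd => [|[|[|]]].
by apply/eqP; rewrite -addr_eq0 -(mulrI_eq0 _ (mulrI U)) -subr_sqr_1 sq subrr.
Qed.

Lemma natr_Zp_modn (d m n : nat) :
  (1 < d)%N -> (d %| m)%N -> (n %% m)%:R = n%:R :> 'Z_d.
Proof.
by move=> d1 dm; apply: val_inj; rewrite /= !val_Zp_nat // modn_dvdm.
Qed.

(** * Computing in Z_p through residues *)

Section PadicResidue.
Variables (p : nat) (hp : prime p).
Implicit Types x y : padic_int p.

Let pX_gt1 n : (1 < p ^ n.+1)%N.
Proof. exact: prime_expn_gt1. Qed.

Let ltZp n (u : 'Z_(p ^ n.+1)) : (u < p ^ n.+1)%N.
Proof. by rewrite -{2}(Zp_cast (pX_gt1 n)). Qed.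

Lemma padic_resM n x y : padic_res (x * y) n = padic_res x n * padic_res y n.
Proof. by []. Qed.

Lemma padic_res_nat n m : padic_res (m%:R : padic_int p) n = m%:R.
Proof. by elim: m => // m IH; rewrite -!natr1 -IH. Qed.

Lemma padic_res_signX n m : padic_res ((-1) ^+ m : padic_int p) n = (-1) ^+ m.
Proof. by elim: m => // m IH; rewrite !exprS -IH. Qed.

Lemma padic_res_unit n y : y \is a GRing.unit -> padic_res y n \is a GRing.unit.
Proof.
by move=> yU; apply/unitrPr; exists (padic_res y^-1 n); rewrite -padic_resM divrr.
Qed.

Lemma padic_res_div n x y : y \is a GRing.unit ->
  padic_res (x / y) n = padic_res x n / padic_res y n.
Proof.
by move=> yU; apply: (mulIr (padic_res_unit n _ yU)); rewrite -padic_resM !divrK ?padic_res_unit.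
Qed.

Lemma padic_res_modn x n m : (padic_res x (n + m) %% p ^ n.+1 = padic_res x n)%N.
Proof.
elim: m => [|m IH]; first by rewrite addn0 modn_small.
rewrite -{}IH addnS -[in RHS](padic_resP x) val_Zp_nat // modn_dvdm //.
by rewrite dvdn_exp2l // ltnS leq_addr.
Qed.

Lemma natr_padic_res x n m : (n <= m)%N -> (padic_res x m)%:R = padic_res x n.
Proof.
by move=> /subnKC<-; apply: val_inj; rewrite /= val_Zp_nat // padic_res_modn.
Qed.

(** Reduces congruences in Z_p to equalities in a finite ring; the exponent is [n.+1] because
    residue [n] lives modulo p^(n+1). *)
Lemma padic_eqmod_res n x y :
  padic_eqmod n.+1 x y <-> padic_res x n = padic_res y n.
Proof.
split=> [[q xy]|xy].
  apply/eqP; rewrite -subr_eq0 -[X in X == _]/(padic_res (x - y) n) xy.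
  by rewrite -natrX padic_resM padic_res_nat pchar_Zp // mul0r.
pose P := (p ^ n.+1)%N; set d := x - y.
have P0 : (0 < P)%N by rewrite expn_gt0 prime_gt0.
have Pd m : (P %| padic_res d (m + n.+1))%N.
  rewrite /dvdn addnS -addSn addnC padic_res_modn.
  by rewrite -[padic_res d n]/(padic_res x n - padic_res y n) xy subrr.
(* Division by p^(n+1) costs n+1 levels of precision: the quotient modulo p^(m+1) is read off the
   residue of [d] modulo p^(m+n+2). *)
pose q m : 'Z_(p ^ m.+1) := (padic_res d (m + n.+1) %/ P)%:R.
have qP m : (q m.+1 : nat)%:R = q m.
  have dm := padic_res_modn d (m + n.+1) 1.
  rewrite {1}/q val_Zp_nat // natr_Zp_modn ?dvdn_exp2l // /q -dm addn1 addSn.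
  rewrite {1}(divn_eq (padic_res d (m + n.+1).+1) (p ^ (m + n.+1).+1)).
  rewrite -addSn expnD mulnA divnMDl // natrD natrM pchar_Zp // mulr0 add0r.
  by rewrite addSn.
exists (PadicInt qP); apply: padic_int_inj => m.
rewrite -natrX padic_resM padic_res_nat /= /q -natrM mulnC divnK //.
by rewrite natr_padic_res // leq_addr.
Qed.

(** Inverses modulo powers of [p] are unique, so those of the residues are compatible and form a
    p-adic integer. *)
Lemma padic_unit_res x :
  (forall n, padic_res x n \is a GRing.unit) -> x \is a GRing.unit.
Proof.
move=> xU.
have yP n : ((padic_res x n.+1)^-1 : nat)%:R = (padic_res x n)^-1.
  apply: (mulrI (xU n)); rewrite (divrr (xU n)) -(padic_resP x n) -natrM.
  have /(congr1 val) /= := divrr (xU n.+1); rewrite [X in (_ %% X)%N]Zp_cast // => E.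
  by rewrite -(natr_Zp_modn _ (p ^ n.+2)) ?dvdn_exp2l // E.
apply/unitrP; exists (PadicInt yP).
by split; apply: padic_int_inj => n; [exact: mulVr (xU n)|exact: mulrV (xU n)].
Qed.

(** The stable residues are compatible and define a limit of [u]. *)
Lemma padic_res_lim (u : nat -> padic_int p) :
  (forall n m, (n <= m)%N -> padic_res (u n.+1) n = padic_res (u m.+1) n) ->
  forall n, padic_res (lim (u @ \oo)%classic) n = padic_res (u n.+1) n.
Proof.
move=> uC.
have lP n : (padic_res (u n.+2) n.+1 : nat)%:R = padic_res (u n.+1) n.
  by rewrite padic_resP -uC.
have ul : (u @ \oo --> PadicInt lP)%classic.
  move=> A [e _ eA]; exists e.+1 => // -[//|m] /= em; apply: eA => /=.
  apply: (@padic_eqmod_leq _ _ e.+1) => //; apply/padic_eqmod_res => /=.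
  by rewrite (uC e m).
move: (cvgP _ ul) => cu n.
(* Uniqueness of limits is avoided: a late term of [u] is congruent to [lim] modulo p^(n+1) and
   already has the stable residue. *)
have [N _ NP] := cu _ (ex_intro2 _ _ n.+1 I (fun=> id)).
have /= /padic_eqmod_res <- := NP (maxn N n).+1 (leqW (leq_maxl _ _)).
by rewrite -uC // leq_maxr.
Qed.

End PadicResidue.

(** * The numbers z_n and the unit parts of factorials *)

Section PadicZ.
Variables (p : nat) (hp : prime p).

Let pX_gt1 n : (1 < p ^ n.+1)%N.
Proof. exact: prime_expn_gt1. Qed.

Lemma padic_res_zseq alpha n m : (n <= m)%N ->
  padic_res (padic_zseq p alpha n.+1) n = padic_res (padic_zseq p alpha m.+1) n.
Proof.
move=> /subnKC<-; elim: (m - n)%N => [|d ->]; first by rewrite addn0.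
rewrite addnS /padic_zseq; set k := (n + d).+1.
have -> : unit_part p (alpha * p ^ k.+1)`! =
    (unit_part p (alpha * p ^ k)`! * coprime_prod p (alpha * p ^ d.+1 * p ^ n.+1))%N.
  rewrite expnSr mulnA unit_part_fact_mul // -mulnA -expnSr -mulnA -expnD.
  by rewrite addSnnS addnC addSn.
rewrite !padic_resM !padic_res_signX !padic_res_nat natrM.
rewrite natr_coprime_prod_mul ?dvdnn ?dvdn_exp //.
(* A factor [p] is taken out of the exponent so that [natr_coprime_prodX] applies. The remaining
   sign exponent has the parity of [p * alpha], matching the sign change in [padic_zseq]. *)
have -> : (alpha * p ^ d.+1 = p * (alpha * p ^ d))%N by rewrite expnS mulnCA.
rewrite (exprM (_%:R)) natr_coprime_prodX // -exprM mulrCA -exprD [RHS]mulrC.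
congr (_ * _).
rewrite -[LHS]signr_odd -[RHS]signr_odd; congr (_ ^+ nat_of_bool _).
rewrite !(oddD, oddM, oddX, oddS).
by case: (odd p); case: (odd alpha) => //; rewrite orbT /= negbK addbT.
Qed.

(** [M] stays free because the factorial of n p^(m+1) occurs in the sequence for [unit_part p n]
    only at the later index m + 1 + [logn p n]. *)
Lemma padic_res_z n m M : (m <= M)%N ->
  padic_res (padic_z p n) m = padic_res (padic_zseq p (unit_part p n) M.+1) m.
Proof.
move=> mM; rewrite -(padic_res_zseq _ _ _ mM).
apply: (padic_res_lim _ hp (padic_zseq p (unit_part p n))) => i j.
exact: padic_res_zseq.
Qed.

Lemma natr_unit_part_fact n e : (unit_part p (n * p ^ e.+1)`!)%:R =
  (-1) ^+ (p * n * (e.+1 + logn p n)) * padic_res (padic_z p n) e :> 'Z_(p ^ e.+1).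
Proof.
rewrite (padic_res_z _ _ _ (leq_addr (logn p n) e)) padic_resM padic_res_signX.
rewrite padic_res_nat mulrA -exprD -addSn -{2}(unit_part_split p n hp).
set u := unit_part p n; set v := logn p n.
have -> : (u * p ^ (e.+1 + v) = n * p ^ e.+1)%N.
  by rewrite addnC expnD mulnA unit_part_split.
rewrite -signr_odd !(oddD, oddM, oddX).
(* [p * n] and [p * u] have the same parity: n = u p^v, and an even [p] makes both even. *)
have -> : odd p && (odd u && ((v == 0)%N || odd p)) = odd p && odd u.
  by case: (odd p); rewrite ?orbT ?andbT.
by rewrite addbb mul1r.
Qed.

(** Up to sign, each residue is the unit part of a factorial, hence prime to [p]. This makes the
    division by z_b z_(a-b) a genuine one. *)
Lemma padic_z_unit n : padic_z p n \is a GRing.unit.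
Proof.
apply: padic_unit_res => // e.
suff : (-1) ^+ (p * n * (e.+1 + logn p n)) * padic_res (padic_z p n) e
    \is a @GRing.unit 'Z_(p ^ e.+1) by rewrite unitrMr // unitrX // unitrN1.
rewrite -natr_unit_part_fact unitZpE // coprimeXl // coprime_unit_part //.
exact: fact_gt0.
Qed.

End PadicZ.

Theorem theorem1p3 (p : nat) (hp : prime p) (a b : nat)
  (hb : (1 <= b)%N) (hba : (b <= a)%N)
  (hpos : (0 < a - b)%N) (hab : logn p (a - b) = 0%N)
  (k : nat) (hk : [:: logn p a; logn p b] =i [:: 0%N; k])
  (c : nat) (hc : (logn p a = k /\ c = a) \/ (logn p b = k /\ c = b))
  (e : nat) (he : (0 < e)%N) :
  padic_eqmod e
    (unit_part p 'C(a * p ^ e, b * p ^ e))%:R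
    ((-1) ^+ (p * c * k) * (padic_z p a / (padic_z p b * padic_z p (a - b)))).
Proof.
case: e he => [//|e] _; apply/(padic_eqmod_res _ hp).
(* At least one of the two valuations is 0 and the other is [k], so only the term belonging to [c]
   can survive. *)
have ck : (c * k = a * logn p a + b * logn p b)%N.
  have := hk (logn p a); have := hk (logn p b); have := hk 0%N.
  rewrite !inE !eqxx !orbT.
  case: hc => -[<- ->]; case: (logn p a) => [|v]; case: (logn p b) => [|w] //=;
    by rewrite ?muln0 ?addn0.
have zU m := padic_z_unit p hp m.
rewrite padic_resM padic_res_signX padic_res_nat padic_res_div ?unitrM ?zU //.
rewrite padic_resM.
set A := padic_res _ _; set B := padic_res _ _; set D := padic_res _ _.
have BDU : B * D \is a GRing.unit by rewrite unitrM !padic_res_unit.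
apply: (mulIr BDU); rewrite -[RHS]mulrA divrK //.
(* With the denominator cleared, the claim follows from the multiplicativity of unit parts in the
   identity linking the binomial to the factorials. *)
have := @bin_fact (a * p ^ e.+1)%N (b * p ^ e.+1)%N.
rewrite leq_mul2r hba orbT -mulnBl => /(_ isT) /(congr1 (unit_part p)).
rewrite !unit_partM ?muln_gt0 ?fact_gt0 ?bin_gt0 ?leq_mul2r ?hba ?orbT //.
move/(congr1 (fun m => m%:R : 'Z_(p ^ e.+1))); rewrite !natrM.
rewrite !natr_unit_part_fact // -/A -/B -/D hab addn0.
set C := (unit_part _ _)%:R; set i := (_ * _ * _)%N; set j := (_ * _ * _)%N.
set l := (_ * _ * _)%N => CBD.
have -> : C * (B * D) = (-1) ^+ (i + j) * (C * ((-1) ^+ i * B * ((-1) ^+ j * D))).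
  by rewrite mulrACA -exprD (mulrCA C ((-1) ^+ _)) signrMK.
rewrite CBD mulrA -exprD; congr (_ * _).
(* i + j + l = 2pa(e+1) + p(a ν(a) + b ν(b)), which has the parity of [p * c * k] by [ck]. *)
rewrite -[LHS]signr_odd -[RHS]signr_odd; congr (_ ^+ nat_of_bool _).
rewrite -mulnA ck /i /j /l !(oddD, oddM) oddB // /=.
by case: (odd p); case: (odd a); case: (odd b); case: (odd e);
  case: (odd (logn p a)); case: (odd (logn p b)).
Qed.
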